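(* Let $H$ be a Hilbert space, and let $R,M>0$ and $A>0$. There exist continuous functions $F,\widetilde F:B(0,R)\to\mathbb{R}$ such that $$\mathcal G_{R,M}(F,\widetilde F)=0,\qquad \sup_{\|x\|\le R}|F(x)-\widetilde F(x)|\ge A.$$
   Context: $B(0,R)=\{x\in H:\|x\|\le R\}$. For $F:B(0,R)\to\mathbb{R}$, the vertical distance-to-epigraph map is, for $x\in B(0,R)$ and $t\in\mathbb{R}$, $$d_F^{\mathrm v}(x,t):=\inf_{s\ge F(x)}|t-s|=(F(x)-t)_+,\qquad (r)_+:=\max\{r,0\}.$$ With $C_{R,M}:=\{(x,t)\in H\times\mathbb{R}:\ \|x\|\le R,\ |t|\le M\}$, the localized vertical epigraphic gauge is $$\mathcal G_{R,M}(F,\widetilde F):=\sup_{(x,t)\in C_{R,M}}\bigl|d_F^{\mathrm v}(x,t)-d_{\widetilde F}^{\mathrm v}(x,t)\bigr|.$$ *)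

(* Defs.v *)
From HB Require Import structures.
From mathcomp Require Import all_boot all_order all_algebra.
From mathcomp Require Import all_classical all_reals all_analysis.

Set Implicit Arguments.
Unset Strict Implicit.
Unset Printing Implicit Defensive.

Import Order.TTheory GRing.Theory Num.Theory.
Import numFieldNormedType.Exports.

Local Open Scope classical_set_scope.
Local Open Scope ring_scope.

(* A real Hilbert space is a complete normed space over K together with an
   inner product (a symmetric positive definite bilinear form) inducing its
   norm. *)
Definition induces_norm (K : realType) (H : completeNormedModType K)
    (ip : {dot H for idfun}) : Prop :=
  forall x : H, ip x x = `|x| ^+ 2.

Definition cball0 (K : realType) (H : normedModType K) (R : K) : set H :=
  [set x | `|x| <= R].

(* Functions on the ball are represented by total functions on H; everything
   below depends only on their restriction to the ball. *)

Definition vdist (K : realType) (H : normedModType K) (F : H -> K)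
    (x : H) (t : K) : K :=
  inf [set `|t - s| | s in [set s | F x <= s]].

Lemma vdistE (K : realType) (H : normedModType K) (F : H -> K) (x : H) (t : K) :
  vdist F x t = Num.max (F x - t) 0.
Proof.
have F0 : [set `|t - s| | s in [set s | F x <= s]] (Num.max (F x - t) 0).
  exists (Num.max (F x) t); first by rewrite /= le_max lexx.
  have [Ft|tF] := leP (F x) t.
    by rewrite subrr normr0; apply/esym/max_idPr; rewrite subr_le0.
  rewrite distrC gtr0_norm ?subr_gt0//; apply/esym/max_idPl.
  by rewrite subr_ge0 ltW.
apply/eqP; rewrite eq_le; apply/andP; split.
  by apply: ge_inf => //; exists 0 => _ [s _ <-]; exact: normr_ge0.
apply: lb_le_inf; first by exists (Num.max (F x - t) 0).
move=> _ [s /= Fs <-]; rewrite ge_max normr_ge0 andbT distrC.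
by apply: le_trans (ler_norm _); rewrite lerD2r.
Qed.

Definition cylinder (K : realType) (H : normedModType K) (R M : K) :
    set (H * K) :=
  [set p | `|p.1| <= R /\ `|p.2| <= M].

(* Suprema are taken in the extended reals: the real-valued [sup] of an
   unbounded set is a default value, and a continuous function on a ball of an
   infinite-dimensional space may be unbounded. *)

Definition vgauge (K : realType) (H : normedModType K) (R M : K)
    (F F' : H -> K) : \bar K :=
  ereal_sup [set (`|vdist F p.1 p.2 - vdist F' p.1 p.2|)%:E
            | p in @cylinder K H R M].

Definition unif_dist (K : realType) (H : normedModType K) (R : K)
    (F F' : H -> K) : \bar K :=
  ereal_sup [set (`|F x - F' x|)%:E | x in @cball0 K H R].

(* Main.v *)
Require Import Defs.
From HB Require Import structures.
From mathcomp Require Import all_boot all_order all_algebra.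
From mathcomp Require Import all_classical all_reals all_analysis.

(** The truncation at height [M] hides everything that happens below [-M]: a
    point of the cylinder has height [t >= -M], so a function with values at
    most [-M] has that point in its epigraph, at distance [0]
    ([vdist_epigraph]). Two functions lying below [-M] are thus at gauge [0]
    from each other ([vgauge_eq0_below]), whatever their uniform distance; the
    constants [-M] and [-M - A] are at uniform distance [A]. *)

Import Order.TTheory GRing.Theory Num.Theory.
Import numFieldNormedType.Exports.

Local Open Scope classical_set_scope.
Local Open Scope ring_scope.

Lemma vdist_epigraph (K : realType) (H : normedModType K) (F : H -> K)
    (x : H) (t : K) : F x <= t -> vdist F x t = 0.
Proof. by move=> Ft; rewrite vdistE; apply/max_idPr; rewrite subr_le0. Qed.

Lemma vgauge_eq0_below (K : realType) (H : normedModType K) (R M : K)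
    (F F' : H -> K) : 0 <= R -> 0 <= M ->
  (forall x, `|x| <= R -> F x <= - M) ->
  (forall x, `|x| <= R -> F' x <= - M) ->
  vgauge R M F F' = 0%E.
Proof.
move=> R0 M0 FM F'M.
have dist0 (p : H * K) : cylinder R M p ->
    `|vdist F p.1 p.2 - vdist F' p.1 p.2| = 0.
  move=> [pR]; rewrite ler_norml => /andP[Mp _].
  rewrite !vdist_epigraph ?subrr ?normr0//.
  - exact: le_trans (F'M _ pR) Mp.
  - exact: le_trans (FM _ pR) Mp.
apply/eqP; rewrite eq_le; apply/andP; split.
  by apply: ge_ereal_sup => _ [p /dist0 p0 <-]; rewrite p0.
(* The supremum is [0] and not [-oo] because the cylinder contains the origin. *)
have C0 : cylinder R M (0 : H * K) by split; rewrite normr0.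
by apply: ereal_sup_ubound; exists 0 => //; rewrite dist0.
Qed.

Theorem proposition3 (K : realType) (H : completeNormedModType K)
    (ip : {dot H for idfun}) (ip_norm : induces_norm ip)
    (R M A : K) (R_gt0 : 0 < R) (M_gt0 : 0 < M) (A_gt0 : 0 < A) :
  exists F F' : H -> K,
    [/\ {within cball0 R, continuous F},
        {within cball0 R, continuous F'},
        vgauge R M F F' = 0%E
      & (A%:E <= unif_dist R F F')%E].
Proof.
exists (cst (- M)), (cst (- M - A)); split.
- by apply: continuous_subspaceT => x; exact: cvg_cst.
- by apply: continuous_subspaceT => x; exact: cvg_cst.
- apply: vgauge_eq0_below => [||x _|x _] //=; [exact: ltW|exact: ltW|].
  by rewrite gerBl ltW.
- apply: ereal_sup_ubound; exists 0; first by rewrite /cball0 /= normr0 ltW.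
  by rewrite /= opprB addrC subrK gtr0_norm.
Qed.
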